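(* Let $\Gamma$ be a finitely generated abelian group with a bilinear map $\langle\,,\,\rangle:\Gamma\times\Gamma\to\mathbb{Z}_2$, and let $\mathcal{A}$ be an arbitrary (not necessarily associative) $\Gamma$-commutative algebra. (i) There exists $n$ such that $\mathcal{A}$ is $(\mathbb{Z}_2)^n$-commutative; that is, there exist an integer $n$, a bilinear map $(\mathbb{Z}_2)^n\times(\mathbb{Z}_2)^n\to\mathbb{Z}_2$, and a $(\mathbb{Z}_2)^n$-grading of $\mathcal{A}$ making $\mathcal{A}$ a $(\mathbb{Z}_2)^n$-commutative algebra with respect to this bilinear map. (ii) The bilinear map on $(\mathbb{Z}_2)^n$ can be chosen (for a suitable $n$ and a suitable $(\mathbb{Z}_2)^n$-grading of $\mathcal{A}$) as the usual scalar product $\langle x,y\rangle=\sum_{i=1}^n x_iy_i\in\mathbb{Z}_2$.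
   Context: $\Gamma$-commutative algebra: given an abelian group $(\Gamma,+)$ and a bilinear map $\langle\,,\,\rangle:\Gamma\times\Gamma\to\mathbb{Z}_2$ (additive in each argument), an algebra $\mathcal{A}$ is $\Gamma$-commutative if it is $\Gamma$-graded, $\mathcal{A}=\bigoplus_{\gamma\in\Gamma}\mathcal{A}_\gamma$ with $\mathcal{A}_\gamma\cdot\mathcal{A}_{\gamma'}\subset\mathcal{A}_{\gamma+\gamma'}$, and $ab=(-1)^{\langle\bar a,\bar b\rangle}\,ba$ for all homogeneous $a,b\in\mathcal{A}$, where $\bar a,\bar b\in\Gamma$ denote the degrees. $(\mathbb{Z}_2)^n$-commutative means the same with $\Gamma$ replaced by $(\mathbb{Z}_2)^n$.
   Formalization: In part (ii) the given bilinear map on Γ is additionally assumed symmetric; without symmetry (ii) is false (e.g. for some algebra over Q with Γ = (Z_2)^4 and <x,y> = x1y2 + x3y4). Part (i) is stated without this assumption. *)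

(* Defs.v *)
From HB Require Import structures.
From mathcomp Require Import all_boot all_order all_algebra.

Set Implicit Arguments.
Unset Strict Implicit.
Unset Printing Implicit Defensive.

Import GRing.Theory.
Local Open Scope ring_scope.

Definition finitely_generated (G : zmodType) : Prop :=
  exists (k : nat) (e : 'I_k -> G),
    forall x : G, exists c : 'I_k -> int, x = \sum_(i < k) e i *~ c i.

Definition biadditive (G : zmodType) (f : G -> G -> 'F_2) : Prop :=
  (forall x y z, f (x + y) z = f x z + f y z) /\
  (forall x y z, f x (y + z) = f x y + f x z).

Definition dotp (n : nat) (x y : 'rV['F_2]_n) : 'F_2 :=
  \sum_(i < n) x 0 i * y 0 i.

(* A homogeneous component is a Prop-valued predicate: [A] may have infinite
   dimension, and membership need not be decidable. *)
Definition is_submodule (K : comNzRingType) (A : lmodType K)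
    (P : A -> Prop) : Prop :=
  [/\ P 0, forall a b, P a -> P b -> P (a + b)
    & forall (k : K) a, P a -> P (k *: a)].

(* The module is the internal direct sum of the family [gr]; the index group
   may be infinite, so the sums range over finite duplicate-free lists. *)
Definition direct_sum (G : zmodType) (K : comNzRingType) (A : lmodType K)
    (gr : G -> A -> Prop) : Prop :=
  [/\ forall g, is_submodule (gr g),
      forall a : A, exists (s : seq G) (c : G -> A),
        [/\ uniq s, forall g, gr g (c g) & a = \sum_(g <- s) c g]
    & forall (s : seq G) (c : G -> A),
        uniq s -> (forall g, gr g (c g)) -> \sum_(g <- s) c g = 0 ->
        forall g, g \in s -> c g = 0].

Definition grading (G : zmodType) (K : comNzRingType) (A : lmodType K)
    (mul : {bilinear A -> A -> A}) (gr : G -> A -> Prop) : Prop :=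
  direct_sum gr /\
  (forall g h a b, gr g a -> gr h b -> gr (g + h) (mul a b)).

(* The exponent is the representative in {0, 1} of [f g h : 'F_2]. *)
Definition graded_commutative (G : zmodType) (f : G -> G -> 'F_2)
    (K : comNzRingType) (A : lmodType K)
    (mul : {bilinear A -> A -> A}) (gr : G -> A -> Prop) : Prop :=
  grading mul gr /\
  (forall g h a b, gr g a -> gr h b ->
     mul a b = (-1) ^+ (f g h : nat) *: mul b a).

(* Main.v *)
Require Import Defs.
From HB Require Import structures.
From mathcomp Require Import all_boot all_order all_algebra.
Import GRing.Theory.
Local Open Scope ring_scope.

Set Implicit Arguments.
Unset Strict Implicit.
Unset Printing Implicit Defensive.

(** The grading is pushed forward along a homomorphism [phi] from [G] to a
    vector space over F_2: the new component of degree [h] is the sum of the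
    old components whose degree lies in the fibre of [phi] over [h]. The result
    is again a grading of the algebra, and the commutation rule survives for
    any biadditive [f'] with [f' (phi x) (phi y) = f x y]
    ([pushforward_graded_commutative]). So the whole question is about [f]
    alone: it has to be pulled back from a form on some F_2^n.

    For this, let e_1, ..., e_k generate [G] and send [x] to the vector
    [phi x] of all values f(x, e_j) and f(e_j, x); this only involves [f], so
    relations between the generators cause no trouble. If B is the Gram matrix
    (f(e_i, e_j)), then [phi] sends the element with coordinate row r to r M
    with M = [B, B^T], and f is r B r'^T. With P a generalized inverse of M
    (M P M = M), the columns of B and of B^T being columns of M, one gets
    M (P B P^T) M^T = B: the form of matrix F = P B P^T pulls back to f
    ([biadditive_factors]), which settles the general case; F is symmetric if
    f is.

    For the scalar product, every symmetric matrix F over F_2 is a product V V^T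
    ([symmetric_F2_gram]); then x |-> (phi x) V pulls the scalar product back
    to f. *)

(** * Pushing a grading forward along a homomorphism *)

Section Pushforward.

Context {G H : zmodType} {K : comNzRingType} {A : lmodType K}.
Variables (phi : G -> H) (gr : G -> A -> Prop).

(** The span of the components in the fibre over [h]. Closure under adding one
    homogeneous element at a time makes bilinear identities provable by
    induction on each factor. *)
Inductive pushforward (h : H) : A -> Prop :=
| pushforward0 : pushforward h 0
| pushforwardD g a b :
    phi g = h -> gr g a -> pushforward h b -> pushforward h (a + b).

Lemma pushforward_add h a b :
  pushforward h a -> pushforward h b -> pushforward h (a + b).
Proof.
move=> pa pb; elim: pa => [|g a1 a2 phig gra _ IH]; first by rewrite add0r.
by rewrite -addrA; apply: pushforwardD phig gra IH.
Qed.

Lemma pushforward_sum h (I : Type) (s : seq I) (P : pred I) (F : I -> A) :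
  (forall i, P i -> pushforward h (F i)) ->
  pushforward h (\sum_(i <- s | P i) F i).
Proof.
move=> PF; apply: (big_ind (pushforward h)) => //.
- exact: pushforward0.
- exact: pushforward_add.
Qed.

Lemma pushforward_gr g a : gr g a -> pushforward (phi g) a.
Proof.
by move=> gra; rewrite -[a]addr0; apply: pushforwardD gra (pushforward0 _).
Qed.

Lemma pushforward_submodule h :
  (forall g, is_submodule (gr g)) -> is_submodule (pushforward h).
Proof.
move=> sub; split; [exact: pushforward0 | exact: pushforward_add |].
move=> k a; elim=> [|g a1 a2 phig gra _ IH]; first by rewrite scaler0; left.
rewrite scalerDr; apply: pushforwardD phig _ IH.
by case: (sub g) => _ _; apply.
Qed.

(** Lists of pairs (degree, element) may repeat a degree, so that sums of
    elements are concatenations of lists. *)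
Definition homogeneous_list (S : seq (G * A)) : Prop :=
  forall p, p \in S -> gr p.1 p.2.

Lemma pushforward_list h a :
  pushforward h a ->
  exists S : seq (G * A),
    [/\ homogeneous_list S, forall p, p \in S -> phi p.1 = h
      & a = \sum_(p <- S) p.2].
Proof.
elim=> [|g a1 a2 phig gra _ [S [grS phiS ->]]].
  by exists [::]; split; rewrite ?big_nil.
exists ((g, a1) :: S); split; last by rewrite big_cons.
- by move=> p; rewrite inE => /predU1P[->|/grS].
- by move=> p; rewrite inE => /predU1P[->|/phiS].
Qed.

(** A single list serves all the degrees in [t], because the lists for distinct
    degrees have their own degrees in disjoint fibres. *)
Lemma pushforward_lists (t : seq H) (c : H -> A) :
  uniq t -> (forall h, pushforward h (c h)) ->
  exists S : seq (G * A),
    [/\ homogeneous_list S, forall p, p \in S -> phi p.1 \in t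
      & forall h, h \in t -> c h = \sum_(p <- S | phi p.1 == h) p.2].
Proof.
move=> + pc; elim: t => [|h t IH] /=; first by exists [::].
case/andP=> ht /IH[S [grS phiS cS]].
have [s [grs phis ch]] := pushforward_list (pc h).
exists (s ++ S); split.
- by move=> p; rewrite mem_cat => /orP[/grs|/grS].
- move=> p; rewrite mem_cat inE => /orP[/phis->|/phiS->]; first by rewrite eqxx.
  by rewrite orbT.
- move=> h'; rewrite inE big_cat /= => /predU1P[->|h't].
    rewrite [X in _ + X]big1_seq ?addr0; last first.
      by move=> p /andP[/eqP ph /phiS]; rewrite ph (negPf ht).
    by rewrite ch big_seq [RHS]big_seq_cond; apply: eq_bigl => p;
      case: (boolP (p \in s)) => // /phis->; rewrite eqxx.
  rewrite big1_seq ?add0r; first exact: cS.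
  by move=> p /andP[/eqP + /phis ph]; rewrite ph => hh'; rewrite hh' h't in ht.
Qed.

End Pushforward.

Lemma sum_fibers (I T : eqType) (V : nmodType) (s : seq I) (t : seq T)
    (F : I -> V) (phi : I -> T) (P : pred T) :
  uniq t -> (forall i, i \in s -> phi i \in t) ->
  \sum_(h <- t | P h) \sum_(i <- s | phi i == h) F i
  = \sum_(i <- s | P (phi i)) F i.
Proof.
move=> ut phis; rewrite (exchange_big_dep (fun i => P (phi i))) /=; last first.
  by move=> h i Ph /eqP->.
rewrite big_seq_cond [RHS]big_seq_cond; apply: eq_bigr => i /andP[/phis it Pi].
rewrite -big_filter (_ : [seq _ <- t | _] = [:: phi i]) ?big_seq1 //.
rewrite -(filter_pred1_uniq ut it); apply: eq_filter => h /=.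
by rewrite eq_sym; case: eqP => [->|_]; rewrite ?Pi ?andbF.
Qed.

Section PushforwardGrading.

Context {G H : zmodType} {K : comNzRingType} {A : lmodType K}.
Variables (phi : G -> H) (gr : G -> A -> Prop).

Lemma direct_sum_list_eq0 (S : seq (G * A)) g :
  direct_sum gr -> homogeneous_list gr S -> \sum_(p <- S) p.2 = 0 ->
  \sum_(p <- S | p.1 == g) p.2 = 0.
Proof.
case=> sub _ ind grS S0.
have [gS|gS] := boolP (g \in map fst S); last first.
  apply: big1_seq => p /andP[/eqP pg pS].
  by case/negP: gS; rewrite -pg; apply: map_f.
apply: (ind (undup (map fst S)) (fun g => \sum_(p <- S | p.1 == g) p.2)).
- exact: undup_uniq.
- move=> g'; rewrite big_seq_cond.
  case: (sub g') => gr0 grD _; apply: (big_ind (gr g')) => //.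
  by move=> p /andP[/grS + /eqP <-].
- rewrite (@sum_fibers _ _ _ _ _ _ _ xpredT) ?undup_uniq // => p pS.
  by rewrite mem_undup map_f.
- by rewrite mem_undup.
Qed.

(** Each fibre sum regroups old components, and distinct fibres involve
    different ones; so a relation between fibre sums is a relation between old
    components, which is trivial. *)
Lemma pushforward_direct_sum : direct_sum gr -> direct_sum (pushforward phi gr).
Proof.
move=> ds; have [sub ex _] := ds; split.
- by move=> h; apply: pushforward_submodule.
- move=> a; have [s [c [us grc ->]]] := ex a.
  exists (undup (map phi s)), (fun h => \sum_(g <- s | phi g == h) c g); split.
  + exact: undup_uniq.
  + move=> h; apply: pushforward_sum => g /eqP <-.
    exact/pushforward_gr/grc.
  + rewrite (@sum_fibers _ _ _ _ _ _ _ xpredT) ?undup_uniq // => g gs.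
    by rewrite mem_undup map_f.
- move=> t c ut pc c0 h ht.
  have [S [grS phiS cS]] := pushforward_lists ut pc.
  have S0 : \sum_(p <- S) p.2 = 0.
    transitivity (\sum_(h <- t) c h) => //.
    rewrite -(@sum_fibers _ _ _ S t snd (fun p => phi p.1) xpredT) //.
    by rewrite big_seq [RHS]big_seq; apply: eq_bigr => h' /cS.
  (* Each old component of the list vanishes, so every fibre sums to zero. *)
  rewrite cS // -(@sum_fibers _ _ _ S (undup (map fst S)) snd fst
                   (fun g => phi g == h)) ?undup_uniq //; last first.
    by move=> p pS; rewrite mem_undup map_f.
  by apply: big1 => g _; apply: direct_sum_list_eq0.
Qed.

(** Both the multiplicativity and the commutation rule are bilinear, hence
    need only be checked on the old components; there the hypotheses on [phi]
    turn the old rules into the new ones. *)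
Lemma pushforward_graded_commutative (f : G -> G -> 'F_2) (f' : H -> H -> 'F_2)
    (mul : {bilinear A -> A -> A}) :
  {morph phi : x y / x + y} -> (forall x y, f' (phi x) (phi y) = f x y) ->
  graded_commutative f mul gr ->
  graded_commutative f' mul (pushforward phi gr).
Proof.
move=> phiD f'E [[ds grM] comm]; split; first split.
- exact: pushforward_direct_sum.
- move=> h k a b pa pb; elim: pa => [|g a1 a2 <- gra _ IHa].
    by rewrite linear0l; left.
  rewrite linearDl; apply: pushforward_add IHa.
  elim: pb => [|g' b1 b2 <- grb _ IHb]; first by rewrite linear0r; left.
  rewrite linearDr; apply: pushforward_add IHb.
  by rewrite -phiD; apply/pushforward_gr/grM.
- move=> h k a b pa pb; elim: pa => [|g a1 a2 <- gra _ IHa].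
    by rewrite linear0l linear0r scaler0.
  rewrite linearDl linearDr scalerDr IHa; congr (_ + _).
  elim: pb => [|g' b1 b2 <- grb _ IHb].
    by rewrite linear0l linear0r scaler0.
  by rewrite linearDl linearDr scalerDr IHb f'E (comm g g').
Qed.

End PushforwardGrading.

(** * Factoring a biadditive map through F_2^n *)

Lemma morphD_sum_mulrz (G V : zmodType) (h : G -> V) (k : nat) (e : 'I_k -> G)
    (c : 'I_k -> int) :
  {morph h : x y / x + y} ->
  h (\sum_(i < k) e i *~ c i) = \sum_(i < k) h (e i) *~ c i.
Proof.
move=> hD.
have h0 : h 0 = 0 by apply: (addIr (h 0)); rewrite -hD !add0r.
have hB : zmod_morphism h.
  by move=> x y; apply: (addIr (h y)); rewrite -hD !subrK.
pose h' : {additive G -> V} := HB.pack h (GRing.isZmodMorphism.Build G V h hB).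
rewrite -[h]/(h' : G -> V) raddf_sum.
by apply: eq_bigr => i _; rewrite raddfMz.
Qed.

(** Recording the values of [f] on both sides of the generators makes both B and
    B^T factor through the matrix M of [phi], so that a form on the whole of
    F_2^n can be written down without extending one from the image of [phi]. *)
Lemma biadditive_factors (G : zmodType) (f : G -> G -> 'F_2) :
  finitely_generated G -> biadditive f ->
  exists (n : nat) (phi : G -> 'rV['F_2]_n) (F : 'M['F_2]_n),
    [/\ {morph phi : x y / x + y},
        forall x y, (phi x *m F *m (phi y)^T) 0 0 = f x y
      & (forall x y, f x y = f y x) -> F^T = F].
Proof.
move=> [k [e gen]] [fDl fDr].
pose B : 'M['F_2]_k := \matrix_(i, j) f (e i) (e j).
pose M := row_mx B B^T.
have [P MPM] : exists P, M *m P *m M = M.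
  by exists (pinvmx M); rewrite mulmxKpV ?submx_refl.
pose phi x : 'rV['F_2]_(k + k) := row_mx (\row_j f x (e j)) (\row_j f (e j) x).
have coordl x y c : x = \sum_(i < k) e i *~ c i ->
    f x y = \sum_i (c i)%:~R * f (e i) y.
  move=> ->; rewrite (@morphD_sum_mulrz _ _ (f^~ y)) => [|u v]; last exact: fDl.
  by apply: eq_bigr => i _; rewrite mulrzl.
have coordr x y c : y = \sum_(i < k) e i *~ c i ->
    f x y = \sum_i (c i)%:~R * f x (e i).
  move=> ->; rewrite (@morphD_sum_mulrz _ _ (f x)) => [|u v]; last exact: fDr.
  by apply: eq_bigr => i _; rewrite mulrzl.
have phiE x c : x = \sum_(i < k) e i *~ c i ->
    phi x = (\row_i (c i)%:~R) *m M.
  move=> xE; rewrite mul_mx_row; congr row_mx; apply/rowP => j; rewrite !mxE.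
    by rewrite (coordl _ _ _ xE); apply: eq_bigr => i _; rewrite !mxE.
  by rewrite (coordr _ _ _ xE); apply: eq_bigr => i _; rewrite !mxE.
have MPB : M *m P *m B = B.
  have -> : B = M *m col_mx 1%:M 0.
    by rewrite mul_row_col mulmx1 mulmx0 addr0.
  by rewrite mulmxA MPM.
have MPBT : M *m P *m B^T = B^T.
  have -> : B^T = M *m col_mx 0 1%:M.
    by rewrite mul_row_col mulmx1 mulmx0 add0r.
  by rewrite mulmxA MPM.
exists (k + k)%N, phi, (P *m B *m P^T); split.
- move=> x y; rewrite /phi add_row_mx.
  by congr row_mx; apply/rowP => j; rewrite !mxE.
- move=> x y; have [[c xE] [d yE]] := (gen x, gen y).
  rewrite (phiE _ _ xE) (phiE _ _ yE) trmx_mul !mulmxA.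
  rewrite -(mulmxA _ M P) -(mulmxA _ _ B) MPB.
  have BPM : B *m P^T *m M^T = B.
    by apply: trmx_inj; rewrite !trmx_mul !trmxK mulmxA.
  rewrite -(mulmxA _ B) -(mulmxA _ (B *m P^T)) BPM.
  rewrite (coordl _ _ _ xE) -mulmxA mxE; apply: eq_bigr => i _.
  rewrite (coordr _ _ _ yE) !mxE; congr (_ * _); apply: eq_bigr => j _.
  by rewrite !mxE mulrC.
- move=> fC; rewrite !trmx_mul trmxK mulmxA; congr (_ *m _ *m _).
  by apply/matrixP => i j; rewrite !mxE.
Qed.

(** * Symmetric matrices over F_2 are Gram matrices *)

(** Write S = U + U^T + D with U strictly upper triangular and D diagonal.
    In characteristic two, (1 + U) (1 + U)^T + 1 + U U^T = U + U^T, and D D^T = D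
    because every element of F_2 is its own square; so the block row
    [1 + U, 1, U, D] has Gram matrix S. *)
Lemma symmetric_F2_gram (n : nat) (S : 'M['F_2]_n) :
  S^T = S -> exists (m : nat) (V : 'M['F_2]_(n, m)), V *m V^T = S.
Proof.
move=> ST.
pose U : 'M['F_2]_n := \matrix_(i, j) if (i < j)%N then S i j else 0.
pose D := diag_mx (\row_i S i i).
have addmm (X : 'M['F_2]_n) : X + X = 0.
  by apply/matrixP => i j; rewrite !mxE (addrr_pchar2 (pchar_Fp _)).
have SE : S = U + U^T + D.
  apply/matrixP => i j; rewrite !mxE.
  case: (ltngtP i j) => [ij|ij|/val_inj <-].
  - by rewrite -val_eqE /= (ltn_eqF ij) !addr0.
  - by rewrite -val_eqE /= (gtn_eqF ij) addr0 add0r -[in LHS]ST mxE.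
  - by rewrite eqxx !add0r.
have DDT : D *m D^T = D.
  rewrite tr_diag_mx mulmx_diag; congr diag_mx; apply/rowP => i; rewrite !mxE.
  by case: (S i i) => [[|[|//]]] ?; apply: val_inj.
exists (n + (n + (n + n)))%N.
exists (row_mx (1%:M + U) (row_mx 1%:M (row_mx U D))).
rewrite !tr_row_mx !mul_row_col DDT [RHS]SE !addrA; congr (_ + _).
rewrite linearD /= trmx1 mulmxDl !mul1mx mulmxDr !mulmx1.
have -> : 1%:M + U^T + (U + U *m U^T) + 1%:M + U *m U^T
  = (U + U^T) + ((1%:M + 1%:M) + (U *m U^T + U *m U^T)).
  by rewrite [LHS](AC ((2*2)*1*1) ((3*2)*((1*5)*(4*6)))).
by rewrite !addmm !addr0.
Qed.

(** * Reduction of the grading group *)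

Lemma dotpE n (x y : 'rV['F_2]_n) : dotp x y = (x *m y^T) 0 0.
Proof. by rewrite mxE; apply: eq_bigr => i _; rewrite mxE. Qed.

Unset Implicit Arguments.
Set Strict Implicit.

Theorem theorem2 (G : zmodType) (f : G -> G -> 'F_2)
    (K : comNzRingType) (A : lmodType K) (mul : {bilinear A -> A -> A})
    (gr : G -> A -> Prop) :
  finitely_generated G -> biadditive f -> graded_commutative f mul gr ->
  (exists (n : nat) (f' : 'rV['F_2]_n -> 'rV['F_2]_n -> 'F_2)
          (gr' : 'rV['F_2]_n -> A -> Prop),
     biadditive f' /\ graded_commutative f' mul gr')
  /\
  ((forall x y, f x y = f y x) ->
   exists (n : nat) (gr' : 'rV['F_2]_n -> A -> Prop),
     graded_commutative (@dotp n) mul gr').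
Proof.
move=> fgG fB grC.
have [n [phi [F [phiD phiF FT]]]] := biadditive_factors fgG fB.
split=> [|fC].
  exists n, (fun x y => (x *m F *m y^T) 0 0), (pushforward phi gr); split.
    by split=> x y z; rewrite ?linearD /= ?mulmxDl ?mulmxDr mxE.
  exact: pushforward_graded_commutative phiD phiF grC.
have [m [V VVT]] := symmetric_F2_gram (FT fC).
exists m, (pushforward (fun x => phi x *m V) gr).
apply: pushforward_graded_commutative grC => x y.
  by rewrite phiD mulmxDl.
by rewrite dotpE trmx_mul mulmxA -(mulmxA _ V) VVT.
Qed.
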